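(* Let $(\mathbf{A},\mathbf{E})$ be a regular matrix pencil, $\mathbf{A},\mathbf{E}\in\mathbb{C}^{n\times n}$. Let the columns of $\mathbf{V}\in\mathbb{C}^{n\times k}$ ($k\ge1$) form an orthonormal basis for a $k$-dimensional invariant subspace of $(\mathbf{A},\mathbf{E})$ associated with finite eigenvalues, let $\mu\in\mathbb{C}$ be any number for which $\mathbf{A}-\mu\mathbf{E}$ is invertible, and let $\widehat{\mathbf{G}}=\mathbf{V}^*(\mathbf{A}-\mu\mathbf{E})^{-1}\mathbf{E}\mathbf{V}$. For any $\varepsilon>0$ there exists some nonzero initial condition $\mathbf{x}(0)\in\mathrm{Ran}(\mathbf{Q}_\mu)$ such that the solution $\mathbf{x}(t)$ of $\mathbf{E}\mathbf{x}'(t)=\mathbf{A}\mathbf{x}(t)$ satisfies $$\sup_{t\ge0}\frac{\|\mathbf{x}(t)\|}{\|\mathbf{x}(0)\|}\ge\frac{\alpha_\varepsilon(\widehat{\mathbf{G}}^{-1})+\mathrm{Re}\,\mu}{\varepsilon}.$$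
   Context: $\|\cdot\|$ is the Euclidean vector norm and the matrix norm it induces, with the convention $\|\mathbf{X}^{-1}\|=\infty$ when $\mathbf{X}$ is a square matrix that is not invertible; orthonormality is with respect to the Euclidean inner product. $\mathrm{Ran}(\cdot)$ is the column space. The pencil $(\mathbf{A},\mathbf{E})$ is regular if $\mathbf{A}-\mu\mathbf{E}$ is invertible for some $\mu\in\mathbb{C}$. An invariant subspace of $(\mathbf{A},\mathbf{E})$ associated with finite eigenvalues means a subspace that is invariant under $\mathbf{E}_\nu:=(\mathbf{A}-\nu\mathbf{E})^{-1}\mathbf{E}$ and on which $\mathbf{E}_\nu$ has only nonzero eigenvalues, for $\nu\in\mathbb{C}$ with $\mathbf{A}-\nu\mathbf{E}$ invertible (this property does not depend on the choice of such $\nu$). For a square matrix $\mathbf{B}$, $\sigma_\varepsilon(\mathbf{B}):=\{z\in\mathbb{C}:\|(z\mathbf{I}-\mathbf{B})^{-1}\|>1/\varepsilon\}$ and $\alpha_\varepsilon(\mathbf{B}):=\sup_{z\in\sigma_\varepsilon(\mathbf{B})}\mathrm{Re}\,z$. For $\mu\in\mathbb{C}$ with $\mathbf{A}-\mu\mathbf{E}$ invertible, let $d$ be the algebraic multiplicity of $0$ as an eigenvalue of $\mathbf{E}_\mu:=(\mathbf{A}-\mu\mathbf{E})^{-1}\mathbf{E}$, and take a Schur factorization $$\mathbf{E}_\mu=[\mathbf{Q}_\mu\ \widetilde{\mathbf{Q}}_\mu]\begin{bmatrix}\mathbf{G}_\mu&\mathbf{D}_\mu\\ \mathbf{0}&\mathbf{N}_\mu\end{bmatrix}[\mathbf{Q}_\mu\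 \widetilde{\mathbf{Q}}_\mu]^*$$ with $[\mathbf{Q}_\mu\ \widetilde{\mathbf{Q}}_\mu]$ unitary, $\mathbf{Q}_\mu\in\mathbb{C}^{n\times(n-d)}$, the middle factor upper triangular, $\mathbf{N}_\mu\in\mathbb{C}^{d\times d}$ nilpotent, and $\mathbf{G}_\mu\in\mathbb{C}^{(n-d)\times(n-d)}$ with $0\notin\sigma(\mathbf{G}_\mu)$. The initial conditions consistent with the differential-algebraic equation $\mathbf{E}\mathbf{x}'(t)=\mathbf{A}\mathbf{x}(t)$ are exactly those $\mathbf{x}(0)\in\mathrm{Ran}(\mathbf{Q}_\mu)$, and each such $\mathbf{x}(0)$ determines a unique solution. *)

(* Defs.v *)
From mathcomp Require Import all_boot all_order all_algebra.
From mathcomp Require Export complex.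
From mathcomp Require Import all_classical all_reals all_analysis.
Import numFieldNormedType.Exports.
Import Order.TTheory GRing.Theory Num.Theory.

Set Implicit Arguments.
Unset Strict Implicit.
Unset Printing Implicit Defensive.

Local Open Scope classical_set_scope.
Local Open Scope complex_scope.
Local Open Scope sesquilinear_scope.
Local Open Scope ring_scope.

(* The complex numbers are R[i], with R : realType the real numbers.
   M ^t* is the conjugate transpose. *)

Definition enorm (R : realType) (n : nat) (v : 'cV[R[i]]_n) : R :=
  Num.sqrt (\sum_(i < n) Normc.normc (v i 0) ^+ 2).

Definition mxnorm (R : realType) (m n : nat) (M : 'M[R[i]]_(m, n)) : \bar R :=
  ereal_sup [set (enorm (M *m v))%:E | v in [set v | enorm v <= 1]].

(* The case distinction is the convention that a singular matrix has an inverse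
   of infinite norm; [invmx] alone would return the matrix itself. *)
Definition invnorm (R : realType) (n : nat) (X : 'M[R[i]]_n) : \bar R :=
  if X \in unitmx then mxnorm (invmx X) else +oo%E.

Definition Ran (R : realType) (m n : nat) (M : 'M[R[i]]_(m, n)) :
  set 'cV[R[i]]_m := range (fun w : 'cV[R[i]]_n => M *m w).

Definition regular_pencil (R : realType) (n : nat) (A E : 'M[R[i]]_n) : Prop :=
  exists mu : R[i], A - mu *: E \in unitmx.

Definition pencil_shift (R : realType) (n : nat) (A E : 'M[R[i]]_n) (nu : R[i]) :
  'M[R[i]]_n := invmx (A - nu *: E) *m E.

(* Used for linear subspaces S. The condition does not depend on the
   admissible nu, so asking for it at one nu or at every nu is the same. *)
Definition finite_invariant_subspace (R : realType) (n : nat)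
    (A E : 'M[R[i]]_n) (S : set 'cV[R[i]]_n) : Prop :=
  exists nu : R[i],
    [/\ A - nu *: E \in unitmx,
        forall v, S v -> S (pencil_shift A E nu *m v) &
        forall (lambda : R[i]) (v : 'cV[R[i]]_n), S v -> v != 0 ->
          pencil_shift A E nu *m v = lambda *: v -> lambda != 0].

Definition pseudospectrum (R : realType) (n : nat) (eps : R) (B : 'M[R[i]]_n) :
  set R[i] := [set z | ((1 / eps)%:E < invnorm (z%:M - B))%E].

Definition pseudoabscissa (R : realType) (n : nat) (eps : R) (B : 'M[R[i]]_n) :
  \bar R := ereal_sup [set (complex.Re z)%:E | z in pseudospectrum eps B].

(* [row_mx Q Qt] is formally n x ((n - d) + d). As d <= n this is square, so
   orthonormality of its rows, which is what [unitarymx] asks of a rectangular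
   matrix, is unitarity. [is_trig_mx] means lower triangular. *)
Definition schur_factorization (R : realType) (n : nat) (M : 'M[R[i]]_n)
    (d : nat) (Q : 'M[R[i]]_(n, n - d)) (Qt : 'M[R[i]]_(n, d))
    (G : 'M[R[i]]_(n - d)) (D : 'M[R[i]]_(n - d, d)) (N : 'M[R[i]]_d) : Prop :=
  [/\ d = mup 0 (char_poly M),
      row_mx Q Qt \is unitarymx,
      M = row_mx Q Qt *m block_mx G D 0 N *m (row_mx Q Qt)^t*,
      is_trig_mx (block_mx G D 0 N)^T &
      (exists p : nat, N ^+ p = 0) /\ ~~ eigenvalue G 0].

(* Derivative at t of a function on [0, +oo[; one-sided when t = 0. *)
Definition is_derive_ge0 (R : realType) (f : R -> R) (t df : R) : Prop :=
  h^-1 * (f (t + h) - f t) @[h --> within [set h | 0 <= t + h] 0^'] --> df.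

Definition is_vderive_ge0 (R : realType) (n : nat) (x : R -> 'cV[R[i]]_n)
    (t : R) (dx : 'cV[R[i]]_n) : Prop :=
  forall i : 'I_n,
    is_derive_ge0 (fun s => complex.Re (x s i 0)) t (complex.Re (dx i 0)) /\
    is_derive_ge0 (fun s => complex.Im (x s i 0)) t (complex.Im (dx i 0)).

(* Only the values of x on [0, +oo[ matter. *)
Definition dae_solution (R : realType) (n : nat) (A E : 'M[R[i]]_n)
    (x0 : 'cV[R[i]]_n) (x : R -> 'cV[R[i]]_n) : Prop :=
  x 0 = x0 /\
  forall t : R, 0 <= t ->
    exists2 dx : 'cV[R[i]]_n, is_vderive_ge0 x t dx & E *m dx = A *m x t.

Definition unique_dae_solution (R : realType) (n : nat) (A E : 'M[R[i]]_n)
    (x0 : 'cV[R[i]]_n) (x : R -> 'cV[R[i]]_n) : Prop :=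
  dae_solution A E x0 x /\
  forall y, dae_solution A E x0 y -> forall t : R, 0 <= t -> y t = x t.

(* Main.v *)
(* Invariance yields a matrix C with A V = E V C and Ghat^-1 = C - mu, so that
   x(t) = V exp(tC) c solves the equation for every c, and V is an isometry. The
   bound is then the lower bound of the Kreiss matrix theorem for exp(tC): if
   |exp(tC) c| <= m |c| for all t >= 0 and (z - C) w = u with Re z > 0, then
   |w| <= m |u| / Re z. As the initial condition must attain the supremum over c,
   a compactness argument is needed when all orbits are bounded.
   Solutions are unique because the component on which (A - mu E)^-1 E is
   nilpotent must vanish, and the equation is an explicit linear ODE on the rest. *)
Require Import Defs.
From mathcomp Require Import all_boot all_order all_algebra.
From mathcomp Require Import all_classical all_reals all_analysis.
From mathcomp Require Import ring lra.
Import numFieldNormedType.Exports.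
Import Order.TTheory GRing.Theory Num.Theory.

Set Implicit Arguments.
Unset Strict Implicit.
Unset Printing Implicit Defensive.

Local Open Scope classical_set_scope.
Local Open Scope complex_scope.
Local Open Scope sesquilinear_scope.
Local Open Scope ring_scope.

(** * Calculus of derivatives on the closed half-line, one-sided at [0] *)

Section OneSidedDerivative.
Variable R : realType.
Implicit Types (f g : R -> R) (t : R).

Lemma is_derive_ge0_of_is_derive f t df :
  is_derive t 1 f df -> is_derive_ge0 f t df.
Proof.
move=> fD; rewrite /is_derive_ge0; apply: cvg_within_filter.
have := @ex_derive _ _ _ _ _ _ _ fD; rewrite /derivable => /cvg_ex [l fl].
have <- : l = df.
  by rewrite -(@derive_val _ _ _ _ _ _ _ fD); apply/esym/cvg_lim.
apply: cvg_trans fl; apply: near_eq_cvg; near=> h.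
by rewrite /= [h *: 1]mulr1 [h + t]addrC.
Unshelve. all: by end_near. Qed.

(** At an interior point every increment with [|h| <= t] keeps [t + h] nonnegative, so the
    restriction on [h] disappears near [0]. *)
Lemma is_derive_of_is_derive_ge0 f t df :
  0 < t -> is_derive_ge0 f t df -> is_derive t 1 f df.
Proof.
move=> t0 fD.
suff H : h^-1 *: (f (h *: 1 + t) - f t) @[h --> 0^'] --> df.
  apply: DeriveDef; first by apply/cvg_ex; exists df.
  exact/cvg_lim.
move=> A /fD; rewrite /= /nbhs/= /within/= => nA.
have nt : \forall h \near (0:R)^', `|h| <= t by exact: dnbhs0_le.
suff : (0:R)^' [set h | A (h^-1 *: (f (h *: 1 + t) - f t))] by [].
move: nA nt; apply: filterS2 => h hA ht.
rewrite /= [h *: 1]mulr1 [h + t]addrC; apply: hA.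
by move: ht; rewrite ler_norml => /andP[? _]; rewrite -lerBlDl sub0r.
Qed.

Lemma is_derive_ge0_shift_cvg f t df : is_derive_ge0 f t df ->
  f (t + h) @[h --> within [set h | 0 <= t + h] 0^'] --> f t.
Proof.
move=> fD.
have h0 : h @[h --> within [set h | 0 <= t + h] (0:R)^'] --> (0:R).
  by apply: cvg_within_filter; exact: nbhs_dnbhs.
have := cvgD (cvgM h0 fD) (cvg_cst (f t)).
move=> /(_ _ _ _); rewrite mul0r add0r => fc.
apply: (cvg_trans _ fc); apply: near_eq_cvg.
rewrite near_withinE; near=> h => _; rewrite !fctE/= mulVKf ?subrK//.
by near: h; exact: nbhs_dnbhs_neq.
Unshelve. all: by end_near. Qed.

(** Small increments [h > 0] are always admissible, even at [t = 0], so limits along this filter,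
    and hence one-sided derivatives, are unique. *)
Lemma dnbhs_ge0_proper t : 0 <= t ->
  ProperFilter (within [set h | 0 <= t + h] (0:R)^').
Proof.
move=> t0; split.
  rewrite /within/= => n0.
  have n1 : \forall h \near (0:R)^'+, 0 <= t + h -> False.
    move: n0; rewrite near_withinE near_withinE; apply: filterS => h hF h0.
    by apply: hF; rewrite gt_eqF.
  have : \forall h \near (0:R)^'+, False.
    near=> h; have h0 : 0 < h by near: h; exact: nbhs_right_gt.
    by apply: (near n1 h) => //; rewrite addr_ge0// ltW.
  by move=> /filter_ex[].
exact: within_filter.
Unshelve. all: by end_near. Qed.

Lemma is_derive_ge0_unique f t df dg : 0 <= t ->
  is_derive_ge0 f t df -> is_derive_ge0 f t dg -> df = dg.
Proof.
by move=> /dnbhs_ge0_proper P fD gD; exact: cvg_unique fD gD.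
Qed.

Lemma eq_is_derive_ge0 f g t df : 0 <= t -> (forall s, 0 <= s -> f s = g s) ->
  is_derive_ge0 f t df -> is_derive_ge0 g t df.
Proof.
move=> t0 fg H; apply: (cvg_trans _ H); apply: near_eq_cvg.
rewrite near_withinE; apply: nearW => h th.
by rewrite !fg.
Qed.

Lemma is_derive_ge0_cst (c : R) t : is_derive_ge0 (fun=> c) t 0.
Proof. by apply: is_derive_ge0_of_is_derive; exact: is_derive_cst. Qed.

Lemma is_derive_ge0D f g t df dg : is_derive_ge0 f t df ->
  is_derive_ge0 g t dg -> is_derive_ge0 (fun s => f s + g s) t (df + dg).
Proof.
move=> fD gD; have /(_ _) H := cvgD fD gD; apply: (cvg_trans _ H); apply: near_eq_cvg.
by apply: nearW => h /=; rewrite -mulrDr opprD addrACA.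
Qed.

Lemma is_derive_ge0M f g t df dg : is_derive_ge0 f t df ->
  is_derive_ge0 g t dg ->
  is_derive_ge0 (fun s => f s * g s) t (df * g t + f t * dg).
Proof.
move=> fD gD.
(* The increment of the product is split as [(f (t + h) - f t) * g (t + h) + f t * (g (t + h) - g
   t)], which calls for the limit of [g (t + h)]. *)
have := cvgD (cvgM fD (is_derive_ge0_shift_cvg gD)) (cvgM (cvg_cst (f t)) gD).
move=> /(_ _ _ _ _ _) H; apply: (cvg_trans _ H); apply: near_eq_cvg.
by apply: nearW => h; rewrite !fctE /=; ring.
Qed.

Lemma is_derive_ge0Z (c : R) f t df : is_derive_ge0 f t df ->
  is_derive_ge0 (fun s => c * f s) t (c * df).
Proof.
by move=> /(is_derive_ge0M (is_derive_ge0_cst c t)); rewrite mul0r add0r.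
Qed.

Lemma is_derive_ge0_sum (I : Type) (r : seq I) (F : I -> R -> R) dF t :
  (forall i, is_derive_ge0 (F i) t (dF i)) ->
  is_derive_ge0 (fun s => \sum_(i <- r) F i s) t (\sum_(i <- r) dF i).
Proof.
move=> FD; elim: r => [|i r IH].
  rewrite big_nil (_ : (fun s => _) = fun=> 0); last first.
    by apply/funext => s; rewrite big_nil.
  exact: is_derive_ge0_cst.
rewrite big_cons (_ : (fun s => _) = fun s => F i s + \sum_(j <- r) F j s).
  exact: is_derive_ge0D.
by apply/funext => s; rewrite big_cons.
Qed.

(** Two-sided derivatives are available on the open half-line; at [0] right continuity is enough,
    and the one-sided derivative provides it. *)
Lemma is_derive_ge0_nonincreasing f df :
  (forall t, 0 <= t -> is_derive_ge0 f t (df t)) ->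
  (forall t, 0 <= t -> df t <= 0) ->
  forall t, 0 <= t -> f t <= f 0.
Proof.
move=> fD df0 t t0.
have fD1 (s : R) : 0 < s -> is_derive s 1 f (df s).
  by move=> s0; apply: is_derive_of_is_derive_ge0 => //; apply: fD; exact: ltW.
apply: (@ler0_derive1_nincry _ f 0) => //.
- by move=> x; rewrite in_itv/= andbT => /fD1.
- move=> x; rewrite in_itv/= andbT => x0.
  by rewrite derive1E (@derive_val _ _ _ _ _ _ _ (fD1 _ x0)) df0// ltW.
- apply/continuous_within_itvcyP; split.
    move=> x; rewrite in_itv/= andbT => /fD1 [xD _].
    exact/differentiable_continuous/derivable1_diffP.
  move=> A /(is_derive_ge0_shift_cvg (fD 0 (lexx _))).
  rewrite /fmap/= !near_simpl !near_withinE.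
  apply: filterS => h hA h0; rewrite -[h]add0r; apply: hA; first by rewrite gt_eqF.
  by rewrite /= ?add0r ltW.
Qed.

End OneSidedDerivative.

(** * Euclidean geometry of complex column vectors *)

Section ComplexVectors.
Variable R : realType.
Local Notation Re := (@complex.Re R).
Local Notation Im := (@complex.Im R).

Lemma cReD (x y : R[i]) : Re (x + y) = Re x + Re y.
Proof. by case: x y => [? ?] [? ?]. Qed.

Lemma cImD (x y : R[i]) : Im (x + y) = Im x + Im y.
Proof. by case: x y => [? ?] [? ?]. Qed.

Lemma cReM (x y : R[i]) : Re (x * y) = Re x * Re y - Im x * Im y.
Proof. by case: x y => [? ?] [? ?]. Qed.

Lemma cImM (x y : R[i]) : Im (x * y) = Re x * Im y + Im x * Re y.
Proof. by case: x y => [? ?] [? ?]. Qed.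

Lemma cRe_sum (I : Type) (r : seq I) (F : I -> R[i]) :
  Re (\sum_(i <- r) F i) = \sum_(i <- r) Re (F i).
Proof. by apply: (big_morph Re cReD). Qed.

Lemma cIm_sum (I : Type) (r : seq I) (F : I -> R[i]) :
  Im (\sum_(i <- r) F i) = \sum_(i <- r) Im (F i).
Proof. by apply: (big_morph Im cImD). Qed.

(** The real part of the Hermitian inner product, that is, the Euclidean inner product of the
    underlying real space of dimension [2n]. *)
Definition redot n (u v : 'cV[R[i]]_n) : R :=
  \sum_(i < n) (Re (u i 0) * Re (v i 0) + Im (u i 0) * Im (v i 0)).

Lemma redotC n (u v : 'cV[R[i]]_n) : redot u v = redot v u.
Proof. by apply: eq_bigr => i _; ring. Qed.

Lemma redotDr n (u v w : 'cV[R[i]]_n) : redot u (v + w) = redot u v + redot u w.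
Proof.
rewrite -big_split; apply: eq_bigr => i _ /=; rewrite mxE cReD cImD; ring.
Qed.

Lemma redotDl n (u v w : 'cV[R[i]]_n) : redot (u + v) w = redot u w + redot v w.
Proof. by rewrite redotC redotDr !(redotC w). Qed.

Lemma redotZr n a (u v : 'cV[R[i]]_n) : redot u (a%:C *: v) = a * redot u v.
Proof.
rewrite mulr_sumr; apply: eq_bigr => i _ /=; rewrite mxE cReM cImM /=; ring.
Qed.

Lemma redotZl n a (u v : 'cV[R[i]]_n) : redot (a%:C *: u) v = a * redot u v.
Proof. by rewrite redotC redotZr redotC. Qed.

Lemma redot_scale n (z : R[i]) (u : 'cV[R[i]]_n) :
  redot u (z *: u) = Re z * redot u u.
Proof.
rewrite mulr_sumr; apply: eq_bigr => i _ /=; rewrite mxE cReM cImM /=; ring.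
Qed.

Lemma redot_ge0 n (u : 'cV[R[i]]_n) : 0 <= redot u u.
Proof. by apply: sumr_ge0 => i _; rewrite -!expr2 addr_ge0// sqr_ge0. Qed.

Lemma normc_sqr (x : R[i]) : Normc.normc x ^+ 2 = Re x ^+ 2 + Im x ^+ 2.
Proof. by case: x => a b /=; rewrite sqr_sqrtr// addr_ge0// sqr_ge0. Qed.

Lemma normc_ge0 (x : R[i]) : 0 <= Normc.normc x.
Proof. by case: x => a b /=; rewrite sqrtr_ge0. Qed.

Lemma enormE n (u : 'cV[R[i]]_n) : enorm u = Num.sqrt (redot u u).
Proof.
by congr Num.sqrt; apply: eq_bigr => i _; rewrite normc_sqr !expr2.
Qed.

Lemma enorm_ge0 n (u : 'cV[R[i]]_n) : 0 <= enorm u.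
Proof. exact: sqrtr_ge0. Qed.

Lemma sqr_enorm n (u : 'cV[R[i]]_n) : enorm u ^+ 2 = redot u u.
Proof. by rewrite enormE sqr_sqrtr// redot_ge0. Qed.

Lemma normc_le_enorm n (u : 'cV[R[i]]_n) i : Normc.normc (u i 0) <= enorm u.
Proof.
rewrite -(@ler_pXn2r _ 2)// ?nnegrE ?normc_ge0 ?enorm_ge0//.
rewrite sqr_enorm normc_sqr !expr2 /redot (bigD1 i)//= lerDl.
by apply: sumr_ge0 => j _; rewrite -!expr2 addr_ge0// sqr_ge0.
Qed.

Lemma enorm0 n : enorm (0 : 'cV[R[i]]_n) = 0.
Proof.
by rewrite enormE /redot big1 ?sqrtr0// => i _; rewrite mxE /= !mulr0 addr0.
Qed.

Lemma enorm0_eq0 n (u : 'cV[R[i]]_n) : enorm u = 0 -> u = 0.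
Proof.
move=> u0; apply/matrixP => i j; rewrite ord1 mxE; apply: Normc.eq0_normc.
by apply/eqP; rewrite eq_le normc_ge0 andbT -u0 normc_le_enorm.
Qed.

Lemma enorm_gt0 n (u : 'cV[R[i]]_n) : (0 < enorm u) = (u != 0).
Proof.
rewrite lt_neqAle enorm_ge0 andbT eq_sym; congr (~~ _).
by apply/eqP/eqP => [/enorm0_eq0//|->]; exact: enorm0.
Qed.

Lemma enormZ n a (u : 'cV[R[i]]_n) : enorm (a *: u) = Normc.normc a * enorm u.
Proof.
have -> : Normc.normc a = Num.sqrt (Normc.normc a ^+ 2).
  by rewrite sqrtr_sqr ger0_norm// normc_ge0.
rewrite /enorm -sqrtrM ?sqr_ge0// mulr_sumr.
by congr Num.sqrt; apply: eq_bigr => i _; rewrite mxE Normc.normcM exprMn.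
Qed.

(** Cauchy-Schwarz: with [a = |u|] and [b = |v|], the nonnegative number [|b u - a v|^2] equals
    [2 a b (a b - redot u v)]. *)
Lemma redot_le_enorm n (u v : 'cV[R[i]]_n) : redot u v <= enorm u * enorm v.
Proof.
have [u0|u0] := eqVneq u 0.
  rewrite u0 enorm0 mul0r /redot big1// => i _.
  by rewrite mxE /= !mul0r addr0.
have [v0|v0] := eqVneq v 0.
  rewrite v0 enorm0 mulr0 /redot big1// => i _.
  by rewrite mxE /= !mulr0 addr0.
rewrite -!enorm_gt0 in u0 v0; set a := enorm u in u0 *; set b := enorm v in v0 *.
have := redot_ge0 (b%:C *: u + (- a)%:C *: v).
rewrite redotDl !redotDr !redotZl !redotZr -!sqr_enorm -/a -/b (redotC v u).
have -> : b * (b * a ^+ 2) + b * (- a * redot u v) +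
  (- a * (b * redot u v) + - a * (- a * b ^+ 2)) =
  (2 * (a * b)) * (a * b - redot u v) by ring.
by rewrite pmulr_rge0 ?subr_ge0// !mulr_gt0.
Qed.

Lemma ler_enormD n (u v : 'cV[R[i]]_n) : enorm (u + v) <= enorm u + enorm v.
Proof.
rewrite -(@ler_pXn2r _ 2)// ?nnegrE ?addr_ge0 ?enorm_ge0//.
rewrite sqr_enorm redotDl !redotDr -!sqr_enorm (redotC v u).
have := redot_le_enorm u v; nra.
Qed.

Lemma ler_enorm_sum n (I : Type) (r : seq I) (F : I -> 'cV[R[i]]_n) :
  enorm (\sum_(i <- r) F i) <= \sum_(i <- r) enorm (F i).
Proof.
elim: r => [|i r IH]; first by rewrite !big_nil enorm0.
by rewrite !big_cons (le_trans (ler_enormD _ _))// lerD2l.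
Qed.

Lemma ler_enorm_mulmx m n (A : 'M[R[i]]_(m, n)) v :
  enorm (A *m v) <= (\sum_j enorm (col j A)) * enorm v.
Proof.
have -> : A *m v = \sum_j v j 0 *: col j A.
  apply/matrixP => i k; rewrite ord1 summxE mxE; apply: eq_bigr => j _.
  by rewrite !mxE mulrC.
rewrite (le_trans (ler_enorm_sum _ _))// mulr_suml ler_sum// => j _.
by rewrite enormZ mulrC ler_wpM2l ?enorm_ge0// normc_le_enorm.
Qed.

Lemma enorm_isometry n k (V : 'M[R[i]]_(n, k)) v :
  V^t* *m V = 1%:M -> enorm (V *m v) = enorm v.
Proof.
have dotE m (u : 'cV[R[i]]_m) : complex.Re ((u^t* *m u) 0 0) = redot u u.
  rewrite mxE cRe_sum; apply: eq_bigr => i _; rewrite !mxE.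
  by case: (u i 0) => a b /=; ring.
move=> V1; rewrite !enormE -!dotE trmx_mul map_mxM.
by rewrite mulmxA -(mulmxA _ _ V) V1 mulmx1.
Qed.

End ComplexVectors.

(** * Vector-valued derivatives and energy estimates for linear equations *)

Section VectorDerivative.
Variable R : realType.
Local Notation Re := (@complex.Re R).
Local Notation Im := (@complex.Im R).

Lemma ext_is_derive_ge0 (f g : R -> R) t df :
  f =1 g -> is_derive_ge0 f t df -> is_derive_ge0 g t df.
Proof. by move=> /funext ->. Qed.

Lemma eq_is_vderive_ge0 n (x y : R -> 'cV[R[i]]_n) t dx : 0 <= t ->
  (forall s, 0 <= s -> x s = y s) ->
  is_vderive_ge0 x t dx -> is_vderive_ge0 y t dx.
Proof.
move=> t0 xy xD i; have [reD imD] := xD i.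
by split; [move: reD|move: imD]; apply: eq_is_derive_ge0 => // s s0; rewrite xy.
Qed.

Lemma is_vderive_ge0_unique n (x : R -> 'cV[R[i]]_n) t dx dy : 0 <= t ->
  is_vderive_ge0 x t dx -> is_vderive_ge0 x t dy -> dx = dy.
Proof.
move=> t0 xD yD; apply/matrixP => i j; rewrite ord1.
have [reD imD] := xD i; have [reD' imD'] := yD i.
apply/eqP; rewrite eq_complex (is_derive_ge0_unique t0 reD reD').
by rewrite (is_derive_ge0_unique t0 imD imD') !eqxx.
Qed.

Lemma is_vderive_ge0_cst n (c : 'cV[R[i]]_n) t : is_vderive_ge0 (fun=> c) t 0.
Proof. by move=> i; rewrite mxE; split; exact: is_derive_ge0_cst. Qed.

Lemma is_vderive_ge0D n (x y : R -> 'cV[R[i]]_n) t dx dy :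
  is_vderive_ge0 x t dx -> is_vderive_ge0 y t dy ->
  is_vderive_ge0 (fun s => x s + y s) t (dx + dy).
Proof.
move=> xD yD i; have [reD imD] := xD i; have [reD' imD'] := yD i.
rewrite mxE cReD cImD; split.
  apply: (ext_is_derive_ge0 _ (is_derive_ge0D reD reD')) => s.
  by rewrite mxE cReD.
apply: (ext_is_derive_ge0 _ (is_derive_ge0D imD imD')) => s.
by rewrite mxE cImD.
Qed.

Lemma is_vderive_ge0_mulmx m n (P : 'M[R[i]]_(m, n)) x t dx :
  is_vderive_ge0 x t dx -> is_vderive_ge0 (fun s => P *m x s) t (P *m dx).
Proof.
move=> xD i; split.
  apply: (@ext_is_derive_ge0 (fun s => \sum_j
      (Re (P i j) * Re (x s j 0) + - Im (P i j) * Im (x s j 0)))) => [s|].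
    by rewrite mxE cRe_sum; apply: eq_bigr => j _; rewrite cReM mulNr.
  rewrite mxE cRe_sum; under eq_bigr do rewrite cReM -mulNr.
  apply: (is_derive_ge0_sum (F := fun j s =>
    Re (P i j) * Re (x s j 0) + - Im (P i j) * Im (x s j 0))) => j.
  by have [? ?] := xD j; apply: is_derive_ge0D; exact: is_derive_ge0Z.
apply: (@ext_is_derive_ge0 (fun s => \sum_j
    (Re (P i j) * Im (x s j 0) + Im (P i j) * Re (x s j 0)))) => [s|].
  by rewrite mxE cIm_sum; apply: eq_bigr => j _; rewrite cImM.
rewrite mxE cIm_sum; under eq_bigr do rewrite cImM.
apply: (is_derive_ge0_sum (F := fun j s =>
  Re (P i j) * Im (x s j 0) + Im (P i j) * Re (x s j 0))) => j.
by have [? ?] := xD j; apply: is_derive_ge0D; exact: is_derive_ge0Z.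
Qed.

Lemma is_vderive_ge0B n (x y : R -> 'cV[R[i]]_n) t dx dy :
  is_vderive_ge0 x t dx -> is_vderive_ge0 y t dy ->
  is_vderive_ge0 (fun s => x s - y s) t (dx - dy).
Proof.
move=> xD /(is_vderive_ge0_mulmx (- 1%:M)) yD.
have := is_vderive_ge0D xD yD; rewrite mulNmx mul1mx.
by congr (is_vderive_ge0 _ _ _); apply/funext => s; rewrite mulNmx mul1mx.
Qed.

Lemma is_derive_ge0_redot n (x : R -> 'cV[R[i]]_n) t dx :
  is_vderive_ge0 x t dx ->
  is_derive_ge0 (fun s => redot (x s) (x s)) t (2 * redot (x t) dx).
Proof.
move=> xD; rewrite mulr_sumr; apply: (is_derive_ge0_sum (F := fun i s =>
  Re (x s i 0) * Re (x s i 0) + Im (x s i 0) * Im (x s i 0))) => i.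
have [reD imD] := xD i.
have := is_derive_ge0D (is_derive_ge0M reD reD) (is_derive_ge0M imD imD).
by congr (is_derive_ge0 _ _ _); ring.
Qed.

Lemma is_derive_ge0_expR (a t : R) :
  is_derive_ge0 (fun s => expR (a * s)) t (a * expR (a * t)).
Proof.
apply: is_derive_ge0_of_is_derive.
have -> : (fun s => expR (a * s)) = expR \o (a \*: id) by [].
apply: is_derive_eq.
rewrite /= [_ *: 1]mulr1 mulrC //.
Qed.

(** Gronwall argument: if [a] bounds the operator norm of [K], then [exp(-2at) |x t|^2] is
    nonincreasing, and it starts at [0]. *)
Lemma linear_ode_zero n (K : 'M[R[i]]_n) (x : R -> 'cV[R[i]]_n) :
  (forall t, 0 <= t -> is_vderive_ge0 x t (K *m x t)) -> x 0 = 0 ->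
  forall t, 0 <= t -> x t = 0.
Proof.
move=> xD x0 t t0; pose a := \sum_j enorm (col j K).
pose f s := expR (- (2 * a) * s) * redot (x s) (x s).
pose df s := - (2 * a) * expR (- (2 * a) * s) * redot (x s) (x s) +
  expR (- (2 * a) * s) * (2 * redot (x s) (K *m x s)).
have fD s : 0 <= s -> is_derive_ge0 f s (df s).
  move=> s0; apply: is_derive_ge0M; first exact: is_derive_ge0_expR.
  exact/is_derive_ge0_redot/xD.
have df0 s : 0 <= s -> df s <= 0.
  move=> s0; have e0 := expR_gt0 (- (2 * a) * s).
  have : redot (x s) (K *m x s) <= a * redot (x s) (x s).
    rewrite -sqr_enorm expr2 mulrA [a * _]mulrC -mulrA.
    rewrite (le_trans (redot_le_enorm _ _))// ler_wpM2l ?enorm_ge0//.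
    exact: ler_enorm_mulmx.
  rewrite /df; nra.
have := is_derive_ge0_nonincreasing fD df0 t0; rewrite /f.
rewrite -[redot (x 0) _]sqr_enorm x0 enorm0 expr0n mulr0 pmulr_rle0 ?expR_gt0//.
move=> N0; apply/enorm0_eq0/eqP; rewrite -sqrf_eq0 sqr_enorm.
by rewrite eq_le N0 redot_ge0.
Qed.

Lemma linear_ode_unique n (K : 'M[R[i]]_n) (x y : R -> 'cV[R[i]]_n) :
  (forall t, 0 <= t -> is_vderive_ge0 x t (K *m x t)) ->
  (forall t, 0 <= t -> is_vderive_ge0 y t (K *m y t)) ->
  x 0 = y 0 -> forall t, 0 <= t -> x t = y t.
Proof.
move=> xD yD xy0 t t0; apply/eqP; rewrite -subr_eq0; apply/eqP.
apply: (@linear_ode_zero _ K (fun s => x s - y s)) => //; last first.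
  by rewrite xy0 subrr.
move=> s s0; rewrite mulmxBr.
by apply: is_vderive_ge0B; [exact: xD|exact: yD].
Qed.

(* With [a := Re z], AM-GM makes the squared norm N of y satisfy
   [N' >= a N - m^2 / a], so N would grow exponentially if [N 0 > (m / a)^2]. *)
Lemma resolvent_le n (y g : R -> 'cV[R[i]]_n) (z : R[i])
    (m b : R) :
  0 < Re z -> 0 <= m ->
  (forall t, 0 <= t -> is_vderive_ge0 y t (z *: y t - g t)) ->
  (forall t, 0 <= t -> enorm (g t) <= m) ->
  (forall t, 0 <= t -> enorm (y t) <= b) ->
  Re z * enorm (y 0) <= m.
Proof.
move=> a0 m0 yD gm yb; set a := Re z in a0 *.
rewrite leNgt; apply/negP => ym.
pose N s := redot (y s) (y s).
pose f s := expR (- a * s) * (- N s + m ^+ 2 / a ^+ 2).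
pose df s := - a * expR (- a * s) * (- N s + m ^+ 2 / a ^+ 2) +
  expR (- a * s) * (- 1 * (2 * redot (y s) (z *: y s - g s)) + 0).
have fD s : 0 <= s -> is_derive_ge0 f s (df s).
  move=> s0; apply: is_derive_ge0M; first exact: is_derive_ge0_expR.
  apply: is_derive_ge0D; last exact: is_derive_ge0_cst.
  apply: ext_is_derive_ge0 (is_derive_ge0Z (c := -1) (is_derive_ge0_redot (yD s s0))).
  by move=> r; rewrite mulN1r.
have df0 s : 0 <= s -> df s <= 0.
  move=> s0; rewrite /df -mulrA -[- a * _]mulrCA -mulrDr.
  rewrite pmulr_rle0 ?expR_gt0//.
  have -> : redot (y s) (z *: y s - g s) = a * N s - redot (y s) (g s).
    rewrite redotDr redot_scale -scaleN1r; congr (_ + _).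
    by rewrite -[-1](rmorphN1 (real_complex R)) redotZr mulN1r.
  have yg : redot (y s) (g s) <= enorm (y s) * m.
    rewrite (le_trans (redot_le_enorm _ _))// ler_wpM2l ?enorm_ge0//.
    exact: gm.
  have : 2 * (enorm (y s) * m) <= a * N s + m ^+ 2 / a.
    rewrite /N -sqr_enorm -subr_ge0.
    have -> : a * enorm (y s) ^+ 2 + m ^+ 2 / a - 2 * (enorm (y s) * m) =
      (a * enorm (y s) - m) ^+ 2 / a by field; rewrite gt_eqF.
    by rewrite divr_ge0 ?sqr_ge0// ltW.
  have -> : - a * (- N s + m ^+ 2 / a ^+ 2) = a * N s - m ^+ 2 / a.
    by field; rewrite gt_eqF.
  lra.
pose d := N 0 - m ^+ 2 / a ^+ 2.
have d0 : 0 < d.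
  rewrite subr_gt0 -expr_div_n /N -sqr_enorm ltr_pXn2r ?nnegrE ?enorm_ge0//.
    by rewrite ltr_pdivrMr// mulrC.
  by rewrite divr_ge0// ltW.
(* The exponential growth is weakened to linear growth by [1 + s <= exp s]; this already contradicts
   the bound [b]. *)
have grow t : 0 <= t -> d * (1 + a * t) <= b ^+ 2.
  move=> t0.
  have := is_derive_ge0_nonincreasing fD df0 t0.
  rewrite /f mulr0 expR0 mul1r mulNr expRN mulrC ler_pdivrMr ?expR_gt0// => ft.
  have eat := expR_ge1Dx (a * t).
  have : N t <= b ^+ 2.
    rewrite /N -sqr_enorm ler_pXn2r ?nnegrE ?enorm_ge0 ?yb//.
    by rewrite (le_trans _ (yb t t0)) ?enorm_ge0.
  have : 0 <= m ^+ 2 / a ^+ 2 by rewrite divr_ge0 ?sqr_ge0.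
  have : d * (1 + a * t) <= d * expR (a * t) by rewrite ler_pM2l.
  rewrite /d in ft *; move: ft; nra.
have ad0 : 0 < a * d by rewrite mulr_gt0.
(* This time is chosen so that the left side of [grow] becomes [d + b^2]. *)
have /grow : 0 <= b ^+ 2 / (a * d) by rewrite divr_ge0 ?sqr_ge0 ?ltW.
have -> : d * (1 + a * (b ^+ 2 / (a * d))) = d + b ^+ 2.
  by field; rewrite !gt_eqF.
by rewrite gerDr leNgt d0.
Qed.

End VectorDerivative.

(** * The matrix exponential by power series *)

Section MatrixExponential.
Variable R : realType.
Local Notation Re := (@complex.Re R).
Local Notation Im := (@complex.Im R).

(** The exponential generating function of [b]; keeping the factorials outside [b] turns
    differentiation into a shift of [b]. *)
Definition exp_pseries (b : nat -> R) (t : R) : R :=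
  limn (pseries (fun m => b m / m`!%:R) t).

Lemma cvg_exp_pseries (b : nat -> R) (K B t : R) : 0 <= B ->
  (forall m, `|b m| <= K * B ^+ m) -> cvgn (pseries (fun m => b m / m`!%:R) t).
Proof.
move=> B0 bB; have K0 : 0 <= K.
  by have := bB 0%N; rewrite expr0 mulr1; exact: le_trans.
apply: normed_cvg.
apply: (@series_le_cvg _ _ (K *: exp_coeff (B * `|t|))) => [m|m|m|].
- exact: normr_ge0.
- rewrite /exp_coeff /= mulr_ge0//.
  by rewrite divr_ge0// exprn_ge0// mulr_ge0.
- rewrite /= !normrM normfV normrX (ger0_norm (ler0n _ _)).
  rewrite -[leRHS]/(K * ((B * `|t|) ^+ m / m`!%:R)).
  rewrite exprMn mulrAC 2!mulrA ler_wpM2r ?invr_ge0//.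
  by rewrite ler_wpM2r ?exprn_ge0.
- by apply: is_cvg_seriesZ; exact: is_cvg_series_exp_coeff.
Qed.

(** Termwise differentiation: a geometric bound on [b] passes to its shifts with the same ratio, so
    the series and its first two derived series converge at the radius [|t| + 1], beyond [t]. *)
Lemma is_derive_exp_pseries (b : nat -> R) (K B t : R) : 0 <= B ->
  (forall m, `|b m| <= K * B ^+ m) ->
  is_derive t 1 (exp_pseries b) (exp_pseries (fun m => b m.+1) t).
Proof.
move=> B0 bB.
have dE (c : nat -> R) : pseries_diffs (fun m => c m / m`!%:R) =
    fun m => c m.+1 / m`!%:R.
  apply/funext => m; rewrite /pseries_diffs factS natrM invfM mulrCA.
  by rewrite mulVKf.
have b1 m : `|b m.+1| <= (K * B) * B ^+ m by rewrite -mulrA -exprS.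
have b2 m : `|b m.+2| <= (K * B * B) * B ^+ m by rewrite -!mulrA -!exprS.
have := @pseries_snd_diffs _ (fun m => b m / m`!%:R) (`|t| + 1) t.
rewrite !dE; apply.
- exact: cvg_exp_pseries bB.
- exact: cvg_exp_pseries b1.
- exact: cvg_exp_pseries b2.
- by rewrite [ltRHS]ger0_norm ?ltrDl ?addr_ge0.
Qed.

Lemma exp_pseries0 (b : nat -> R) : exp_pseries b 0 = b 0%N.
Proof.
apply: cvg_lim => //; rewrite -cvg_shiftS /=.
rewrite (_ : (fun n => _) = fun=> b 0%N); first exact: cvg_cst.
apply/funext => m; rewrite /pseries /series /= big_nat_recl//= big1 => [|i _].
  by rewrite fact0 divr1 expr0 mulr1 addr0.
by rewrite expr0n mulr0.
Qed.

(** The form [p * b + q * c] is that of the real and imaginary parts of an entry of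
    [C *m C ^+ m]. *)
Lemma exp_pseries_sum (J : Type) (r : seq J) (p q : J -> R)
    (b c : J -> nat -> R) (t : R) :
  (forall j, cvgn (pseries (fun m => b j m / m`!%:R) t)) ->
  (forall j, cvgn (pseries (fun m => c j m / m`!%:R) t)) ->
  exp_pseries (fun m => \sum_(j <- r) (p j * b j m + q j * c j m)) t =
  \sum_(j <- r) (p j * exp_pseries (b j) t + q j * exp_pseries (c j) t).
Proof.
move=> bc cc; apply: cvg_lim => //.
rewrite (_ : pseries _ _ = fun N => \sum_(j <- r)
    (p j * pseries (fun m => b j m / m`!%:R) t N +
     q j * pseries (fun m => c j m / m`!%:R) t N)); last first.
  apply/funext => N; rewrite /pseries /series /=.
  under eq_bigr do rewrite mulr_suml mulr_suml.
  rewrite exchange_big; apply: eq_bigr => j _; rewrite !mulr_sumr -big_split.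
  by apply: eq_bigr => m _; rewrite /= 2!mulrDl !mulrA.
elim: r => [|j r IH].
  rewrite big_nil (_ : (fun N => _) = fun=> 0); first exact: cvg_cst.
  by apply/funext => N; rewrite big_nil.
rewrite big_cons (_ : (fun N => _) = fun N =>
    (p j * pseries (fun m => b j m / m`!%:R) t N +
     q j * pseries (fun m => c j m / m`!%:R) t N) + \sum_(i <- r)
    (p i * pseries (fun m => b i m / m`!%:R) t N +
     q i * pseries (fun m => c i m / m`!%:R) t N)); last first.
  by apply/funext => N; rewrite big_cons.
apply: cvgD => //; apply: cvgD; (apply: cvgM; first exact: cvg_cst).
  exact: bc.
exact: cc.
Qed.

(** The exponential of [tC], with real and imaginary parts of the entries separated so that only
    real power series occur. *)
Definition expmx n (C : 'M[R[i]]_n) (t : R) : 'M[R[i]]_n :=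
  \matrix_(i, j) (exp_pseries (fun m => Re ((C ^+ m) i j)) t +i*
                  exp_pseries (fun m => Im ((C ^+ m) i j)) t).

Lemma normc_Re (z : R[i]) : `|Re z| <= Normc.normc z.
Proof.
by case: z => x y /=; rewrite -sqrtr_sqr ler_wsqrtr// lerDl sqr_ge0.
Qed.

Lemma normc_Im (z : R[i]) : `|Im z| <= Normc.normc z.
Proof.
by case: z => x y /=; rewrite -sqrtr_sqr ler_wsqrtr// lerDr sqr_ge0.
Qed.

Lemma ler_normc_sum (J : Type) (r : seq J) (F : J -> R[i]) :
  Normc.normc (\sum_(j <- r) F j) <= \sum_(j <- r) Normc.normc (F j).
Proof.
elim: r => [|j r IH]; first by rewrite !big_nil Normc.normc0.
by rewrite !big_cons (le_trans (le_normcD _ _))// lerD2l.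
Qed.

(** The sum of the moduli of all entries dominates every row sum, so each further factor [C] costs
    at most this sum. *)
Lemma ler_normc_exprmx n (C : 'M[R[i]]_n) m i j :
  Normc.normc ((C ^+ m) i j) <= (\sum_i \sum_j Normc.normc (C i j)) ^+ m.
Proof.
set B := \sum_i _.
have B0 : 0 <= B by do 2! apply: sumr_ge0 => ? _; exact: normc_ge0.
elim: m i j => [|m IH] i j.
  rewrite !expr0 mxE; case: (i == j); first by rewrite Normc.normc1.
  by rewrite Normc.normc0.
rewrite !exprS mxE (le_trans (ler_normc_sum _ _))//.
rewrite (@le_trans _ _ (\sum_l Normc.normc (C i l) * B ^+ m))//.
  by apply: ler_sum => l _; rewrite Normc.normcM ler_wpM2l ?normc_ge0.
rewrite -mulr_suml ler_wpM2r ?exprn_ge0// /B [leRHS](bigD1 i)//= lerDl.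
by do 2! apply: sumr_ge0 => ? _; exact: normc_ge0.
Qed.

Lemma expmx0 n (C : 'M[R[i]]_n) : expmx C 0 = 1%:M.
Proof.
apply/matrixP => i j; rewrite mxE !exp_pseries0 expr0.
by rewrite [X in Re X]mxE [X in Im X]mxE mxE; case: (i == j).
Qed.

Lemma is_vderive_ge0_col_expmx n (C : 'M[R[i]]_n) j t :
  is_vderive_ge0 (fun s => col j (expmx C s)) t (col j (C *m expmx C t)).
Proof.
set B := \sum_i \sum_j Normc.normc (C i j).
have B0 : 0 <= B by do 2! apply: sumr_ge0 => ? _; exact: normc_ge0.
have reB i l m : `|Re ((C ^+ m) i l)| <= 1 * B ^+ m.
  by rewrite mul1r (le_trans (normc_Re _))// ler_normc_exprmx.
have imB i l m : `|Im ((C ^+ m) i l)| <= 1 * B ^+ m.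
  by rewrite mul1r (le_trans (normc_Im _))// ler_normc_exprmx.
have reC i l : cvgn (pseries (fun m => Re ((C ^+ m) i l) / m`!%:R) t).
  exact: cvg_exp_pseries (reB i l).
have imC i l : cvgn (pseries (fun m => Im ((C ^+ m) i l) / m`!%:R) t).
  exact: cvg_exp_pseries (imB i l).
move=> i; split.
  apply: (@ext_is_derive_ge0 _ (exp_pseries (fun m => Re ((C ^+ m) i j)))) => [s|].
    by rewrite !mxE.
  suff -> : Re (col j (C *m expmx C t) i 0) =
      exp_pseries (fun m => Re ((C ^+ m.+1) i j)) t.
    by apply: is_derive_ge0_of_is_derive; exact: is_derive_exp_pseries (reB i j).
  rewrite !mxE cRe_sum (_ : (fun m => _) = fun m => \sum_l
      (Re (C i l) * Re ((C ^+ m) l j) + - Im (C i l) * Im ((C ^+ m) l j))).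
    rewrite exp_pseries_sum//; apply: eq_bigr => l _.
    by rewrite cReM !mxE/= mulNr.
  apply/funext => m; rewrite exprS mxE cRe_sum.
  by apply: eq_bigr => l _; rewrite cReM mulNr.
apply: (@ext_is_derive_ge0 _ (exp_pseries (fun m => Im ((C ^+ m) i j)))) => [s|].
  by rewrite !mxE.
suff -> : Im (col j (C *m expmx C t) i 0) =
    exp_pseries (fun m => Im ((C ^+ m.+1) i j)) t.
  by apply: is_derive_ge0_of_is_derive; exact: is_derive_exp_pseries (imB i j).
rewrite !mxE cIm_sum (_ : (fun m => _) = fun m => \sum_l
    (Re (C i l) * Im ((C ^+ m) l j) + Im (C i l) * Re ((C ^+ m) l j))).
  rewrite exp_pseries_sum//; apply: eq_bigr => l _.
  by rewrite cImM !mxE/=.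
apply/funext => m; rewrite exprS mxE cIm_sum.
by apply: eq_bigr => l _; rewrite cImM.
Qed.

Lemma is_vderive_ge0_expmx n (C : 'M[R[i]]_n) c t :
  is_vderive_ge0 (fun s => expmx C s *m c) t (C *m (expmx C t *m c)).
Proof.
have mulE (M : 'M[R[i]]_n) : M *m c = \sum_j (c j 0)%:M *m col j M.
  apply/matrixP => i k; rewrite ord1 summxE mxE; apply: eq_bigr => j _.
  by rewrite mul_scalar_mx !mxE mulrC.
rewrite mulmxA mulE (_ : (fun s => _) =
  fun s => \sum_j (c j 0)%:M *m col j (expmx C s)); last first.
  by apply/funext => s; rewrite mulE.
elim: (index_enum _) => [|j r IH].
  rewrite big_nil (_ : (fun s => _) = fun=> 0); first exact: is_vderive_ge0_cst.
  by apply/funext => s; rewrite big_nil.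
rewrite big_cons (_ : (fun s => _) = fun s => (c j 0)%:M *m col j (expmx C s) +
    \sum_(l <- r) (c l 0)%:M *m col l (expmx C s)); last first.
  by apply/funext => s; rewrite big_cons.
apply: is_vderive_ge0D => //; apply: is_vderive_ge0_mulmx.
exact: is_vderive_ge0_col_expmx.
Qed.

End MatrixExponential.

(** * Uniqueness for the differential-algebraic equation *)

Section DAEUniqueness.
Variable R : realType.

(* Writing the characteristic polynomial of M as 'X^d * q with q(0) <> 0, the
   function [q(M) w] is killed by [M ^+ d], and differentiating the relations
   [M ^+ j *m q(M) *m w = 0] lowers the exponent down to 0. The remaining
   relation [q(M) w = 0] turns the equation into an explicit linear ODE. *)
Lemma implicit_ode_zero n (M : 'M[R[i]]_n) (mu : R[i]) (w : R -> 'cV[R[i]]_n) :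
  (forall t, 0 <= t -> exists2 dw, is_vderive_ge0 w t dw &
     M *m (dw - mu *: w t) = w t) ->
  w 0 = 0 -> forall t, 0 <= t -> w t = 0.
Proof.
case: n => [|n] in M w *; first by move=> _ _ t _; apply/matrixP => -[].
move=> wD w0; have [d [q q0 cpE]] := multiplicity_XsubC (char_poly M) 0.
have {}q0 : q.[0] != 0.
  by move: q0; rewrite monic_neq0 ?char_poly_monic// => /(_ isT).
have pX j : horner_mx M (('X - (0%:P)) ^+ j) = M ^+ j.
  by rewrite rmorphXn /= subr0 horner_mx_X.
pose Q := horner_mx M q.
(* A linear relation with constant coefficients that holds along [w] passes to the derivative. *)
have vd0 (P : 'M[R[i]]_n.+1) : (forall t, 0 <= t -> P *m w t = 0) ->
    forall t dw, 0 <= t -> is_vderive_ge0 w t dw -> P *m dw = 0.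
  move=> Pw t dw t0 tD.
  apply: (is_vderive_ge0_unique t0 (is_vderive_ge0_mulmx P tD)).
  by apply: eq_is_vderive_ge0 (is_vderive_ge0_cst 0 t) => // s s0; rewrite Pw.
have lower j : (forall t, 0 <= t -> (Q * M ^+ j) *m w t = 0) ->
    forall t, 0 <= t -> Q *m w t = 0.
  elim: j => [|j IH] Qw; first by move: Qw; rewrite expr0 mulr1.
  apply: IH => t t0; have [dw tD wE] := wD t t0.
  rewrite -wE mulmxA -[_ *m M]/(Q * M ^+ j * M) -mulrA -exprSr mulmxBr -scalemxAr.
  by rewrite (vd0 _ Qw _ _ t0 tD) Qw// scaler0 subr0.
have Qw t : 0 <= t -> Q *m w t = 0.
  apply: (lower d) => s _.
  by rewrite -pX -rmorphM -cpE /= Cayley_Hamilton mul0mx.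
have [r qE] : exists r, q = q.[0]%:P + r * 'X.
  have /factor_theorem[r rE] : root (q - q.[0]%:P) 0.
    by rewrite rootE !hornerE subrr.
  by exists r; rewrite -[q in LHS](subrK q.[0]%:P) rE subr0 addrC.
have QE : Q = q.[0]%:M + horner_mx M r * M.
  by rewrite /Q {1}qE rmorphD rmorphM /= horner_mx_C horner_mx_X.
(* Since [q = q(0) + r X] and [M (w' - mu w) = w], applying [Q] to [w' - mu w] gives
   [0 = q(0) (w' - mu w) + r(M) w], and [K] solves this for [w']. *)
pose K := mu%:M - q.[0]^-1 *: horner_mx M r.
apply: (@linear_ode_zero _ _ K) => // t t0.
have [dw tD Mdw] := wD t t0.
suff -> : K *m w t = dw by [].
have : Q *m (dw - mu *: w t) = 0.
  by rewrite mulmxBr -scalemxAr (vd0 _ Qw _ _ t0 tD) Qw// scaler0 subr0.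
rewrite QE mulmxDl mul_scalar_mx -[_ * M]/(_ *m M) -mulmxA Mdw => /eqP.
rewrite addr_eq0 => /eqP /(congr1 (fun v => q.[0]^-1 *: v)).
rewrite scalerA mulVf// scale1r scalerN => /eqP; rewrite subr_eq => /eqP ->.
by rewrite /K mulmxBl mul_scalar_mx -scalemxAl addrC.
Qed.

(** Subtracting [mu E w] from [E w' = A w] for the difference [w] and applying [(A - mu E)^-1] gives
    [M (w' - mu w) = w] with [M] the shifted pencil. *)
Lemma dae_solution_unique n (A E : 'M[R[i]]_n) (mu : R[i]) x0 x y :
  A - mu *: E \in unitmx -> dae_solution A E x0 x -> dae_solution A E x0 y ->
  forall t, 0 <= t -> y t = x t.
Proof.
move=> AE [x00 xD] [y00 yD] t t0; apply/eqP; rewrite -subr_eq0; apply/eqP.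
apply: (@implicit_ode_zero _ (pencil_shift A E mu) mu (fun s => y s - x s)) => //.
  move=> s s0; have [dx sD xE] := xD s s0; have [dy sD' yE] := yD s s0.
  exists (dy - dx); first exact: is_vderive_ge0B.
  rewrite /pencil_shift -mulmxA mulmxBr [E *m (dy - dx)]mulmxBr yE xE -mulmxBr.
  by rewrite -scalemxAr scalemxAl -mulmxBl mulKmx.
by rewrite x00 y00 subrr.
Qed.

End DAEUniqueness.

(** * Invariant subspaces, Schur factors and norms of inverses *)

Section LinearAlgebra.
Variable R : realType.

Lemma unitmx_inj n (H : 'M[R[i]]_n) :
  (forall c : 'cV_n, H *m c = 0 -> c = 0) -> H \in unitmx.
Proof.
move=> H0; rewrite unitmxE unitfE; apply/negP; rewrite -det_tr => /det0P[v v0 vH].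
move/negP: v0; apply; rewrite -(trmxK v) (H0 v^T) ?trmx0//.
by rewrite -[H]trmxK -trmx_mul vH trmx0.
Qed.

(** Ensures [n - d + d = n] for the truncated subtraction, so that the Schur basis is a square
    matrix and its adjoint a two-sided inverse. *)
Lemma mup_char_poly_le n (M : 'M[R[i]]_n) a : (mup a (char_poly M) <= n)%N.
Proof.
have cp0 : char_poly M != 0 by rewrite monic_neq0// char_poly_monic.
have : ('X - a%:P) ^+ mup a (char_poly M) %| char_poly M by rewrite -mup_geq.
by move=> /(dvdp_leq cp0); rewrite size_char_poly size_exp_XsubC ltnS.
Qed.

Lemma block_upper_exp (m d : nat) (G : 'M[R[i]]_m) (D : 'M[R[i]]_(m, d)) (N : 'M[R[i]]_d) p :
  exists X, (block_mx G D 0 N : 'M[R[i]]_(m + d)) ^+ p = block_mx (G ^+ p) X 0 (N ^+ p).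
Proof.
elim: p => [|p [X IH]]; first by exists 0; rewrite !expr0 -scalar_mx_block.
exists (G *m X + D *m (N ^+ p)); rewrite !exprS IH -[LHS]/(_ *m _) mulmx_block.
by rewrite !mulmx0 !mul0mx !addr0 !add0r.
Qed.

(** Iterating the relation gives [W = M^p W K^p]. Once [N^p = 0], the lower rows of the [p]-th power
    of the triangular factor vanish, so [M^p] maps into the span of the columns of [Q]. *)
Lemma schur_ran n (M : 'M[R[i]]_n) d (Q : 'M[R[i]]_(n, n - d)) (Qt : 'M[R[i]]_(n, d))
    (G : 'M[R[i]]_(n - d)) (D : 'M[R[i]]_(n - d, d)) (N : 'M[R[i]]_d) k (W : 'M[R[i]]_(n, k))
    (K : 'M[R[i]]_k) :
  schur_factorization M Q Qt G D N -> M *m W *m K = W ->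
  Ran W `<=` Ran Q.
Proof.
move=> [dE Uu ME _ [[p Np] _]] WE _ [c _ <-].
have dn : (d <= n)%N by rewrite dE mup_char_poly_le.
pose U := row_mx Q Qt; pose T : 'M[R[i]]_(n - d + d) := block_mx G D 0 N.
have UU : U^t* *m U = 1%:M.
  by rewrite -[U^t*]mul1mx mulmxKtV// subnK.
have Mexp q : M ^+ q = U *m T ^+ q *m U^t*.
  elim: q => [|q IH]; first by rewrite !expr0 mulmx1; apply/esym/unitarymxP.
  have -> : T ^+ q.+1 = T *m T ^+ q by rewrite exprS.
  rewrite exprS IH -[LHS]/(_ *m _) ME -/U -/T.
  by rewrite -!mulmxA (mulmxA (U^t*)) UU mul1mx.
have WK q : M ^+ q *m W *m K ^+ q = W.
  elim: q => [|q IH]; first by rewrite !expr0 mul1mx mulmx1.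
  rewrite exprSr exprS -[M ^+ q * M]/(_ *m _) -[K * _]/(_ *m _).
  by rewrite -!mulmxA (mulmxA W) (mulmxA M) (mulmxA M) WE mulmxA IH.
have [X TE] := block_upper_exp G D N p.
exists (row_mx (G ^+ p) X *m U^t* *m W *m K ^+ p *m c) => //.
rewrite -{2}(WK p) Mexp /T TE Np /U mul_row_block !mulmx0 !addr0.
by rewrite !mulmxA mul_mx_row.
Qed.

(** The matrix [H] of the shifted pencil on [Ran V] is injective because [0] is not an eigenvalue
    there, and [E V = (A - nu E) V H] rearranges to [A V = E V C] with [C = H^-1 + nu]. For every
    admissible [mu], [E V (C - mu) = (A - mu E) V] is injective, hence so is [C - mu]. *)
Lemma finite_invariant_pencil n k (A E : 'M[R[i]]_n) (V : 'M[R[i]]_(n, k)) :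
  V^t* *m V = 1%:M -> finite_invariant_subspace A E (Ran V) ->
  exists C : 'M[R[i]]_k, A *m V = E *m V *m C /\
    forall mu, A - mu *: E \in unitmx -> C - mu%:M \in unitmx.
Proof.
move=> V1 [nu [AEu inv eig]].
have VI (c : 'cV_k) : V *m c = 0 -> c = 0.
  by move=> Vc; rewrite -[c]mul1mx -V1 -mulmxA Vc mulmx0.
pose S := pencil_shift A E nu; pose H := V^t* *m S *m V.
have SV : S *m V = V *m H.
  apply/matrixP => i j.
  (* Invariance speaks of vectors, so the identity is checked column by column on basis vectors. *)
  have -> : (S *m V) i j = (S *m (V *m delta_mx j (0 : 'I_1))) i 0.
    by rewrite [in RHS]mulmxA -colE [RHS]mxE.
  have -> : (V *m H) i j = (V *m (H *m delta_mx j (0 : 'I_1))) i 0.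
    by rewrite [in RHS]mulmxA -colE [RHS]mxE.
  have [|w _ wE] := inv (V *m delta_mx j 0); first by exists (delta_mx j 0).
  have -> : H *m delta_mx j 0 = V^t* *m (V *m w) by rewrite wE /H !mulmxA.
  by rewrite [V^t* *m _]mulmxA V1 mul1mx wE.
have Hu : H \in unitmx.
  apply: unitmx_inj => c Hc; apply: contrapT => /eqP c0.
  suff /negP : (0 : R[i]) != 0 by [].
  apply: (eig 0 (V *m c)); first by exists c.
    by apply: contraNneq c0 => /VI ->.
  by rewrite mulmxA -/S SV -mulmxA Hc mulmx0 scale0r.
have EV : E *m V = (A - nu *: E) *m V *m H.
  by rewrite -mulmxA -SV /S /pencil_shift !mulmxA mulmxV// mul1mx.
exists (invmx H + nu%:M); split.
  rewrite mulmxDr EV mulmxK// -EV mul_mx_scalar scalemxAl -mulmxDl subrK//.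
move=> mu AEmu; set K := _ - _.
have EVK : E *m V *m K = (A - mu *: E) *m V.
  rewrite mulmxBr mulmxDr EV mulmxK// -EV !mul_mx_scalar !mulmxBl -!scalemxAl.
  by rewrite subrK.
apply: unitmx_inj => c Kc; apply: VI.
by rewrite -[V *m c](mulKmx AEmu) (mulmxA (A - _)) -EVK -mulmxA Kc !mulmx0.
Qed.

(** Treats both cases of the convention alike: an invertible [X] yields [w = X^-1 v] for some [v] in
    the unit ball, a singular one a kernel vector rescaled to norm [b + 1]. *)
Lemma invnorm_gt n (X : 'M[R[i]]_n) (b : R) : 0 <= b -> (b%:E < invnorm X)%E ->
  exists w : 'cV_n, enorm (X *m w) <= 1 /\ b < enorm w.
Proof.
move=> b0; rewrite /invnorm; case: ifPn => [Xu|Xu _].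
  move=> /ereal_sup_gt[_ [v /= v1 <-]]; rewrite lte_fin => bv.
  by exists (invmx X *m v); rewrite mulKVmx.
have [v [v0 Xv]] : exists v : 'cV_n, v != 0 /\ X *m v = 0.
  apply: contrapT => nv; move/negP: Xu; apply; apply: unitmx_inj => c Xc.
  by apply: contrapT => /eqP c0; apply: nv; exists c.
rewrite -enorm_gt0 in v0.
exists (((b + 1) / enorm v)%:C *: v); split.
  by rewrite -scalemxAr Xv scaler0 enorm0.
rewrite enormZ /= expr0n addr0 sqrtr_sqr ger0_norm; last first.
  by rewrite divr_ge0 ?addr_ge0// ltW.
by rewrite divfK ?gt_eqF// ltrDl.
Qed.

End LinearAlgebra.

(** * Maxima of Lipschitz functions on the complex unit sphere *)

Section SphereMaximum.
Variable R : realType.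

(** Real coordinates on the complex space, real parts first, in which the extreme value theorem for
    real row vectors applies. *)
Definition cvec k (v : 'rV[R]_(k + k)) : 'cV[R[i]]_k :=
  \col_i (v 0 (lshift k i) +i* v 0 (rshift k i)).

Lemma cvecB k (u v : 'rV[R]_(k + k)) : cvec (u - v) = cvec u - cvec v.
Proof.
by apply/matrixP => i j; rewrite !mxE.
Qed.

Lemma cvec_surj k (c : 'cV[R[i]]_k) : exists v, cvec v = c.
Proof.
exists (row_mx (\row_i complex.Re (c i 0)) (\row_i complex.Im (c i 0))).
apply/matrixP => i j; rewrite ord1 mxE row_mxEl row_mxEr !mxE.
by case: (c i 0).
Qed.

Lemma mx_norm_entry n (v : 'rV[R]_n) i : `|v 0 i| <= `|v|.
Proof.
by rewrite [leRHS]/Num.norm /= mx_normrE; apply: (le_bigmax _ _ (ord0, i)).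
Qed.

Lemma enorm_cvec_le k (v : 'rV[R]_(k + k)) :
  enorm (cvec v) <= Num.sqrt (k%:R * 2) * `|v|.
Proof.
have -> : `|v| = Num.sqrt (`|v| ^+ 2) by rewrite sqrtr_sqr normr_id.
rewrite -sqrtrM ?mulr_ge0// enormE ler_wsqrtr// -mulrA mulr_natl.
rewrite -[X in _ *+ X]card_ord -sumr_const ler_sum// => i _; rewrite !mxE/=.
have sq j : v 0 j * v 0 j <= `|v| ^+ 2.
  rewrite -expr2 -real_normK ?num_real// ler_pXn2r ?nnegrE//.
  exact: mx_norm_entry.
by rewrite mulr_natl mulr2n lerD.
Qed.

Lemma entry_le_enorm_cvec k (v : 'rV[R]_(k + k)) : `|v| <= enorm (cvec v).
Proof.
rewrite [leLHS]/Num.norm /= mx_normrE; apply: bigmax_le; first exact: enorm_ge0.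
move=> [i j] _ /=; rewrite ord1.
case: (split_ordP j) => l ->; apply: (le_trans _ (normc_le_enorm _ l)); rewrite mxE.
  exact: (normc_Re (v 0 (lshift k l) +i* v 0 (rshift k l))).
exact: (normc_Im (v 0 (lshift k l) +i* v 0 (rshift k l))).
Qed.

(** In real coordinates the sphere is closed and bounded, hence compact, and it is nonempty as
    [1 <= k]. Exchanging [u] and [v] makes the one-sided Lipschitz bound two-sided. *)
Lemma sphere_max k (f : 'cV[R[i]]_k -> R) (L : R) : (1 <= k)%N ->
  (forall u v, f u <= f v + L * enorm (u - v)) ->
  exists2 c0, enorm c0 = 1 & forall c, enorm c = 1 -> f c <= f c0.
Proof.
move=> k1 fL.
(* Stated for any [g] because it serves twice: for [f], and for [enorm], whose level set is the
   sphere. *)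
have lip_cont (g : 'cV[R[i]]_k -> R) M :
    (forall u v, g u <= g v + M * enorm (u - v)) -> continuous (g \o @cvec k).
  move=> gM u; apply/(@cvgrPdist_lt _ _ _ (nbhs u)) => e e0.
  (* The added [1] keeps [B] positive, so that [e / B] is a valid radius. *)
  pose B := `|M| * Num.sqrt (k%:R * 2) + 1.
  have B0 : 0 < B by rewrite ltr_wpDl// mulr_ge0 ?sqrtr_ge0.
  have gB (x y : 'rV[R]_(k + k)) : g (cvec x) - g (cvec y) <= B * `|x - y|.
    rewrite lerBlDl (le_trans (gM _ (cvec y)))// lerD2l -cvecB.
    rewrite (@le_trans _ _ (`|M| * enorm (cvec (x - y))))//.
      by rewrite ler_wpM2r ?enorm_ge0// ler_norm.
    rewrite (@le_trans _ _ (`|M| * (Num.sqrt (k%:R * 2) * `|x - y|)))//.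
      by rewrite ler_wpM2l// enorm_cvec_le.
    by rewrite mulrA /B ler_wpM2r// lerDl.
  have := nbhsx_ballx u _ (divr_gt0 e0 B0); rewrite -ball_normE.
  apply: filterS => v /= uv; rewrite (@le_lt_trans _ _ (B * `|u - v|))//.
    by rewrite ler_norml gB lerNl opprB distrC gB.
  by rewrite -ltr_pdivlMl// mulrC.
have enorm_lip (u v : 'cV[R[i]]_k) : enorm u <= enorm v + 1 * enorm (u - v).
  by rewrite mul1r -{1}(subrKC v u) ler_enormD.
pose S := [set v : 'rV[R]_(k + k) | enorm (cvec v) = 1].
have S0 : S !=set0.
  have [v vE] := cvec_surj (delta_mx (Ordinal k1) 0 : 'cV[R[i]]_k).
  exists v; rewrite /S/= vE enormE /redot (bigD1 (Ordinal k1))//= big1 => [|i ik].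
    by rewrite mxE !eqxx /= mulr0 !addr0 mulr1 sqrtr1.
  by rewrite mxE (negbTE ik)/= !mulr0 addr0.
have Sc : compact S.
  apply: bounded_closed_compact.
    exists 1; split; first exact: num_real.
    move=> M M1 v Sv; rewrite /= (le_trans (entry_le_enorm_cvec v))// Sv.
    exact: ltW.
  rewrite (_ : S = (@enorm R k \o @cvec k) @^-1` [set 1])//.
  apply: preimage_closed; last exact: closed_eq.
  by move=> v _; apply: lip_cont; exact: enorm_lip.
have [v0] := @EVT_max_rV _ _ (f \o @cvec k) S S0 Sc
  (continuous_subspaceT (lip_cont _ _ fL)).
rewrite inE => v01 v0max; exists (cvec v0) => // c c1.
have [v vE] := cvec_surj c; rewrite -vE.
by apply: v0max; rewrite inE /S/= vE.
Qed.

End SphereMaximum.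

(** * The lower Kreiss bound for the matrix exponential *)

Section KreissBound.
Variable R : realType.

(* If some orbit of [expmx C] is unbounded, its initial value will do. If not,
   [c |-> sup_t |expmx C t c|] is Lipschitz and attains its maximum m on the unit
   sphere; for [u := (z - C) w] the orbit [y := expmx C t w] solves
   [y' = z y - expmx C t u], where the last term is at most [m |u|]. *)
Lemma kreiss_lower_bound k (C : 'M[R[i]]_k) (eps : R) : (1 <= k)%N -> 0 < eps ->
  exists2 c0, c0 != 0 & forall z, pseudospectrum eps C z ->
    ((complex.Re z / eps)%:E <= ereal_sup
      [set (enorm (expmx C t *m c0) / enorm c0)%:E | t in [set t : R | (0 <= t)%R]])%E.
Proof.
move=> k1 eps0; pose orb c := [set enorm (expmx C t *m c) | t in [set t : R | 0 <= t]].
have [[c [c0 cu]]|bounded] := pselect (exists c, c != 0 /\ ~ has_ubound (orb c)).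
  exists c => // z _; rewrite -enorm_gt0 in c0.
  have [t t0 tb] : exists2 t : R, 0 <= t &
      complex.Re z / eps * enorm c <= enorm (expmx C t *m c).
    apply: contrapT => nt; apply: cu.
    exists (complex.Re z / eps * enorm c) => _ [t t0 <-].
    by rewrite leNgt; apply/negP => /ltW tb; apply: nt; exists t.
  apply: (le_trans _ (ereal_sup_ubound _)); last by exists t.
  by rewrite lee_fin ler_pdivlMr.
have orb_ub c : has_ubound (orb c).
  have [->|c0] := eqVneq c 0; last by apply: contrapT => cu; apply: bounded; exists c.
  by exists 0 => _ [t _ <-]; rewrite mulmx0 enorm0.
have orb_ne c : orb c !=set0 by exists (enorm (expmx C 0 *m c)), 0 => /=.
have orb_le c t : 0 <= t -> enorm (expmx C t *m c) <= sup (orb c).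
  by move=> t0; apply: ub_le_sup => //; exists t.
(* The orbits of the basis vectors bound the columns of [expmx C t], hence its operator norm,
   uniformly in [t]. *)
pose L := \sum_j sup (orb (delta_mx j 0)).
have expL t c : 0 <= t -> enorm (expmx C t *m c) <= L * enorm c.
  move=> t0; rewrite (le_trans (ler_enorm_mulmx _ _))// ler_wpM2r ?enorm_ge0//.
  by apply: ler_sum => j _; rewrite colE orb_le.
have supL u v : sup (orb u) <= sup (orb v) + L * enorm (u - v).
  apply: ge_sup => // _ [t t0 <-]; rewrite -[in leLHS](subrKC v u) mulmxDr.
  rewrite (le_trans (ler_enormD _ _))// lerD ?orb_le//.
  exact: expL.
have [c0 c01 c0max] := sphere_max k1 supL.
(* Homogeneity extends the maximum from the unit sphere to all vectors. *)
have orbM c t : 0 <= t -> enorm (expmx C t *m c) <= sup (orb c0) * enorm c.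
  move=> t0; have [->|] := eqVneq c 0; first by rewrite mulmx0 enorm0 mulr0.
  rewrite -enorm_gt0 => cp; pose a := (enorm c)^-1.
  have na : Normc.normc a%:C = a.
    by rewrite /= expr0n addr0 sqrtr_sqr ger0_norm// invr_ge0 ltW.
  rewrite -ler_pdivrMr// mulrC -/a -na -enormZ scalemxAr.
  rewrite (le_trans (orb_le _ _ t0))// c0max// enormZ na mulVf//.
  by rewrite gt_eqF.
have supE : ereal_sup [set (enorm (expmx C t *m c0) / enorm c0)%:E |
    t in [set t : R | 0 <= t]] = (sup (orb c0))%:E.
  rewrite -ereal_sup_EFin// image_comp; congr ereal_sup.
  by apply: eq_imagel => t _ /=; rewrite c01 divr1.
exists c0 => [|z zC]; first by rewrite -enorm_gt0 c01.
rewrite supE lee_fin.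
have m0 : 0 <= sup (orb c0).
  exact: le_trans (enorm_ge0 _) (orb_le c0 0 (lexx 0)).
have [z0|z0] := leP (complex.Re z) 0.
  by rewrite (le_trans _ m0)// pmulr_lle0// invr_gt0.
have [|w [w1 ew]] := invnorm_gt _ zC; first by rewrite divr_ge0// ltW.
suff zw : complex.Re z * enorm w <= sup (orb c0).
  by rewrite (le_trans _ zw)// ler_pM2l// ltW// -div1r.
(* Both sides solve [y' = C y] with the same initial value. *)
have commute t : 0 <= t ->
    expmx C t *m ((z%:M - C) *m w) = (z%:M - C) *m (expmx C t *m w).
  apply: (linear_ode_unique (K := C)
    (x := fun s => expmx C s *m ((z%:M - C) *m w))
    (y := fun s => (z%:M - C) *m (expmx C s *m w))) => [s _|s _|].
  - exact: is_vderive_ge0_expmx.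
  - have := is_vderive_ge0_mulmx (z%:M - C) (is_vderive_ge0_expmx C w s).
    rewrite (mulmxA _ C) (mulmxA C) mulmxBl mulmxBr.
    by rewrite mul_scalar_mx mul_mx_scalar.
  - by rewrite expmx0 !mul1mx.
have := @resolvent_le _ _ (fun t => expmx C t *m w)
  (fun t => expmx C t *m ((z%:M - C) *m w)) z (sup (orb c0)) (sup (orb w)) z0 m0.
rewrite expmx0 mul1mx; apply => [t t0|t t0|t t0]; last exact: orb_le.
  rewrite commute// mulmxBl mul_scalar_mx opprB addrC subrK.
  exact: is_vderive_ge0_expmx.
by rewrite (le_trans (orbM _ _ t0))// ler_piMr.
Qed.

End KreissBound.

(** * Transfer of the bound from the exponential to the pencil *)

Theorem corollary5p2 (R : realType) (n k : nat) (A E : 'M[R[i]]_n)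
    (V : 'M[R[i]]_(n, k)) (mu : R[i]) (d : nat)
    (Q : 'M[R[i]]_(n, n - d)) (Qt : 'M[R[i]]_(n, d))
    (G : 'M[R[i]]_(n - d)) (D : 'M[R[i]]_(n - d, d)) (N : 'M[R[i]]_d)
    (eps : R) :
  regular_pencil A E ->
  (1 <= k)%N ->
  V^t* *m V = 1%:M ->
  finite_invariant_subspace A E (Ran V) ->
  A - mu *: E \in unitmx ->
  schur_factorization (pencil_shift A E mu) Q Qt G D N ->
  0 < eps ->
  let Ghat := V^t* *m invmx (A - mu *: E) *m E *m V in
  exists x0 : 'cV[R[i]]_n,
    [/\ x0 != 0, Ran Q x0 &
        exists x : R -> 'cV[R[i]]_n,
          unique_dae_solution A E x0 x /\
          ((pseudoabscissa eps (invmx Ghat) + (complex.Re mu)%:E)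
             * (eps^-1)%:E
           <= ereal_sup [set (enorm (x t) / enorm x0)%:E
                        | t in [set t : R | (0 <= t)%R]])%E].
Proof.
move=> _ k1 V1 Vinv AEmu schur eps0 Ghat.
have [C [AV /(_ mu AEmu) Ku]] := finite_invariant_pencil V1 Vinv.
set K := C - mu%:M in Ku.
have EVK : E *m V *m K = (A - mu *: E) *m V.
  by rewrite /K mulmxBr -AV mul_mx_scalar mulmxBl -scalemxAl.
(* [K] inverts the shifted pencil on [Ran V]: multiplication by [V^t*] makes it the inverse of
   [Ghat], and the same relation places [Ran V] inside [Ran Q]. *)
have MVK : pencil_shift A E mu *m V *m K = V.
  by rewrite /pencil_shift -!mulmxA (mulmxA E) EVK mulKmx.
have GK : Ghat *m K = 1%:M.
  by rewrite /Ghat -V1 -{4}MVK /pencil_shift !mulmxA.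
have -> : invmx Ghat = K.
  by have [Gu _] := mulmx1_unit GK; rewrite -[RHS](mulKmx Gu) GK mulmx1.
have [c0 c00 kreiss] := kreiss_lower_bound C k1 eps0.
have VE c : enorm (V *m c) = enorm c by exact: enorm_isometry.
pose x t := V *m (expmx C t *m c0).
have xsol : dae_solution A E (V *m c0) x.
  split=> [|t _]; first by rewrite /x expmx0 mul1mx.
  exists (V *m (C *m (expmx C t *m c0))).
    exact: is_vderive_ge0_mulmx (is_vderive_ge0_expmx C c0 t).
  by rewrite /x !mulmxA AV.
exists (V *m c0); split; first by rewrite -enorm_gt0 VE enorm_gt0.
  by apply: (schur_ran schur MVK); exists c0.
exists x; split.
  split=> // y ysol; exact: dae_solution_unique AEmu xsol ysol.
rewrite (_ : [set _ | t in _] =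
  [set (enorm (expmx C t *m c0) / enorm c0)%:E | t in [set t : R | 0 <= t]]).
  move: kreiss; set s := ereal_sup _ => kreiss.
  rewrite lee_pdivrMr//.
  have : (pseudoabscissa eps K <= s * eps%:E - (complex.Re mu)%:E)%E.
    apply: ge_ereal_sup => _ [z zK <-].
    (* As [C = K + mu], its pseudospectrum is that of [K] translated by [mu], which accounts for the
       term [Re mu]. *)
    have /kreiss : pseudospectrum eps C (z + mu).
      rewrite /pseudospectrum /= (_ : _ - C = z%:M - K)//.
      by apply/matrixP => i j; rewrite !mxE mulrnDl opprB addrA.
    rewrite EFinM lee_pdivrMr// cReD EFinD leeBrDr//.
  by rewrite leeBrDr.
by apply: eq_imagel => t _; rewrite /x !VE.
Qed.
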